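(* Let $M$ be a manifold, $E$ an oriented vector bundle over $M$ of rank $4n$, $h$ a neutral metric of $E$, and $\nabla$ an $h$-connection of $E$ (a connection with $\nabla h=0$). Let $G:=\{A_0\in SO(2n,2n)\mid A_0\Lambda_n=\Lambda_nA_0\}$. Then a $G$-nilpotent structure of $(E,h,\nabla)$ is just an $\varepsilon$-nilpotent structure of $(E,h)$ parallel with respect to $\nabla$; that is, for $\varepsilon\in\{+,-\}$, an $\varepsilon$-nilpotent structure $N$ of $(E,h)$ is a $G$-nilpotent structure of $(E,h,\nabla)$ if and only if $\nabla N=0$.
   Context: Everything is smooth. $h$ neutral means that $h$ is a bundle metric of signature $(2n,2n)$. An ordered pseudo-orthonormal local frame field $e=(e_1,\dots,e_{4n})$ of $(E,h)$ always has $e_1,\dots,e_{2n}$ space-like ($h(e_i,e_i)=1$) and $e_{2n+1},\dots,e_{4n}$ time-like ($h(e_i,e_i)=-1$). Set $I_{1,\pm}:=\pm1$ and $I_{n,\pm}:={\rm diag}(\pm1,1,\dots,1)$ ($n\times n$) for $n\ge2$; $I'_{4n,\varepsilon}:={\rm diag}(I_n,I_n,I_n,I_{n,\varepsilon})$ (block diagonal), and $$\Lambda_n:=\left[\begin{array}{cccc}O_n&-I_n&O_n&I_n\\ I_n&O_n&I_n&O_n\\ O_n&I_n&O_n&-I_n\\ I_n&O_n&I_n&O_n\end{array}\right],$$ with $I_n$, $O_n$ the $n\times n$ unit and zero matrices. A section $N$ of ${\rm End}\,E$ is an $\varepsilon$-nilpotent structure of $(E,h)$ if on a neighborhood of each point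 of $M$ there is an ordered pseudo-orthonormal local frame field $e$ of $(E,h)$ giving the orientation of $E$ with $NeI'_{4n,\varepsilon}=eI'_{4n,\varepsilon}\Lambda_n$ (frames are treated as row vectors); such an $e$ is called an admissible frame field of $N$. For a Lie subgroup $K$ of $SO(2n,2n)$, an $\varepsilon$-nilpotent structure $N$ of $(E,h)$ is called a $K$-nilpotent structure of $(E,h,\nabla)$ if there exist an open cover $\{U_\lambda\}_{\lambda\in\Lambda}$ of $M$ and a family $\{e_\lambda\}_{\lambda\in\Lambda}$ of admissible frame fields of $N$ such that (i) each $e_\lambda$ is defined on $U_\lambda$; (ii) if $U_\lambda\cap U_\mu\ne\emptyset$, then $e_\mu I'_{4n,\varepsilon}=e_\lambda I'_{4n,\varepsilon}A_{\lambda\mu}$ on $U_\lambda\cap U_\mu$ for a function $A_{\lambda\mu}$ valued in $K$; (iii) the connection form $\omega_\lambda$ of $\nabla$ with respect to $e_\lambda I'_{4n,\varepsilon}$, defined by $\nabla(e_\lambda I'_{4n,\varepsilon})=e_\lambda I'_{4n,\varepsilon}\omega_\lambda$, is valued in the Lie algebra of $K$. *)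

(* Defs.v *)
From HB Require Import structures.
From mathcomp Require Import all_boot all_order all_algebra.
From mathcomp Require Import all_classical all_reals all_analysis.

Set Implicit Arguments.
Unset Strict Implicit.
Unset Printing Implicit Defensive.

Import Order.TTheory GRing.Theory Num.Theory.
Import numFieldNormedType.Exports.

Local Open Scope classical_set_scope.
Local Open Scope ring_scope.

Section SmoothFunctions.
Variables (R : realType) (m : nat).

(* Meant for U open: all partial derivatives of order <= k exist and are
   continuous on U. *)
Fixpoint Ck (k : nat) (U : set 'rV[R]_m) (f : 'rV[R]_m -> R) : Prop :=
  (forall x, U x -> {for x, continuous f}) /\
  match k with
  | 0%N => True
  | k'.+1 => forall i : 'I_m,
      (forall x, U x -> derivable f x (delta_mx 0 i)) /\
      Ck k' U ('D_(delta_mx 0 i) f)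
  end.

Definition Cinfty (U : set 'rV[R]_m) (f : 'rV[R]_m -> R) : Prop :=
  forall k, Ck k U f.

End SmoothFunctions.

Section Manifolds.
Variables (R : realType) (m : nat).

Record chart (T : topologicalType) := Chart {
  dom : set T;
  phi : T -> 'rV[R]_m;
  psi : 'rV[R]_m -> T;
  dom_open : open dom;
  img_open : open (phi @` dom);
  phiK : {in dom, cancel phi psi};
  phi_cont : {within dom, continuous phi};
  psi_cont : {within phi @` dom, continuous psi}
}.

(* The atlas need not be maximal; the smooth structure is the one it
   generates. *)
Record manifold := Manifold {
  carrier :> topologicalType;
  man_hausdorff : hausdorff_space carrier;
  man_countable : @second_countable carrier;
  atlas : set (chart carrier);
  atlas_cover : forall x, exists2 c, atlas c & dom c x;
  atlas_smooth : forall c d, atlas c -> atlas d -> forall i,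
    Cinfty (phi c @` (dom c `&` dom d)) (fun u => phi d (psi c u) 0 i)
}.

Variable M : manifold.

(* Functions, sections and vector fields over an open set W are represented by
   globally defined ones whose values outside W are irrelevant. *)
Definition smooth_on (W : set M) (f : M -> R) : Prop :=
  forall c, atlas c -> Cinfty (phi c @` (dom c `&` W)) (f \o psi c).

Definition smooth_near (x : M) (f : M -> R) : Prop :=
  exists W : set M, [/\ open W, W x & smooth_on W f].

(* Tangent vectors at x are the derivations of the germs at x of smooth
   functions; the last clause normalises the irrelevant values, so that equal
   derivations are equal as functions. *)
Definition tangent (x : M) (v : (M -> R) -> R) : Prop :=
  [/\ forall f g, smooth_near x f -> smooth_near x g ->
        (\forall y \near x, f y = g y) -> v f = v g,
      forall a f g, smooth_near x f -> smooth_near x g ->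
        v (fun y => a * f y + g y) = a * v f + v g,
      forall f g, smooth_near x f -> smooth_near x g ->
        v (fun y => f y * g y) = v f * g x + f x * v g &
      forall f, ~ smooth_near x f -> v f = 0].

Definition smooth_vfield (W : set M) (X : M -> (M -> R) -> R) : Prop :=
  (forall y, W y -> tangent y (X y)) /\
  (forall (V : set M) (f : M -> R), open V -> V `<=` W -> smooth_on V f ->
     smooth_on V (fun y => X y f)).

End Manifolds.

Section Frames.
Variables (R : realType) (V : vectType R) (r : nat).

Definition is_frame (e : 'I_r -> V) : bool :=
  basis_of fullv [tuple e i | i < r].

Definition frame_coord (e : 'I_r -> V) (i : 'I_r) (u : V) : R :=
  coord [tuple e i | i < r] i u.

(* e A, with e a row vector of vectors *)
Definition frame_mul (e : 'I_r -> V) (A : 'M[R]_r) : 'I_r -> V :=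
  fun j => \sum_(i < r) A i j *: e i.

End Frames.

Section Bundles.
Variables (R : realType) (m : nat) (M : manifold R m) (r : nat).

(* A smooth vector bundle of rank r, given by its fibres and a family of local
   trivialisations, i.e. of local frames (U, e), covering M and with smooth
   transition matrices. *)
Record vbundle := VBundle {
  fiber :> M -> vectType R;
  trivs : set (set M * (forall x, 'I_r -> fiber x));
  triv_open : forall U e, trivs (U, e) -> open U;
  triv_frame : forall U e, trivs (U, e) -> forall x, U x -> is_frame (e x);
  triv_cover : forall x, exists U e, trivs (U, e) /\ U x;
  triv_smooth : forall U e V f, trivs (U, e) -> trivs (V, f) -> forall i j,
    smooth_on (U `&` V) (fun x => frame_coord (e x) i (f x j))
}.

Variable E : vbundle.

Definition smooth_section (W : set M) (s : forall x, E x) : Prop :=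
  forall U e, trivs (U, e) -> forall i,
    smooth_on (U `&` W) (fun x => frame_coord (e x) i (s x)).

Definition smooth_section_near (x : M) (s : forall x, E x) : Prop :=
  exists W : set M, [/\ open W, W x & smooth_section W s].

Definition local_frame (W : set M) (e : forall x, 'I_r -> E x) : Prop :=
  [/\ open W, forall x, W x -> is_frame (e x) &
      forall i, smooth_section W (fun x => e x i)].

(* pos x e : e is an ordered basis of the fibre at x giving the orientation *)
Record orientation := Orientation {
  pos :> forall x, ('I_r -> E x) -> Prop;
  pos_frame : forall x (e : 'I_r -> E x), pos e -> is_frame e;
  pos_mul : forall x (e : 'I_r -> E x) (A : 'M[R]_r), pos e ->
    A \in unitmx -> (pos (frame_mul e A) <-> 0 < \det A);
  pos_local : forall x, exists U e,
    [/\ local_frame U e, U x & forall y, U y -> pos (e y)]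
}.

Definition smooth_endo (N : forall x, 'End(E x)) : Prop :=
  forall (W : set M) (s : forall x, E x), open W -> smooth_section W s ->
    smooth_section W (fun x => N x (s x)).

(* A connection as a covariant derivative of local sections:
   cov x v s is nabla_v s for v tangent at x and s a section smooth near x. *)
Record connection := Connection {
  cov :> forall x : M, ((M -> R) -> R) -> (forall y, E y) -> E x;
  cov_local : forall x v s t, tangent x v ->
    smooth_section_near x s -> smooth_section_near x t ->
    (\forall y \near x, s y = t y) -> cov x v s = cov x v t;
  cov_linear : forall x a v w s, tangent x v -> tangent x w ->
    smooth_section_near x s ->
    cov x (fun f => a * v f + w f) s = a *: cov x v s + cov x w s;
  cov_add : forall x v s t, tangent x v ->
    smooth_section_near x s -> smooth_section_near x t ->
    cov x v (fun y => s y + t y) = cov x v s + cov x v t;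
  cov_leibniz : forall x v f s, tangent x v ->
    smooth_near x f -> smooth_section_near x s ->
    cov x v (fun y => f y *: s y) = v f *: s x + f x *: cov x v s;
  cov_smooth : forall (W : set M) X s, open W ->
    smooth_vfield W X -> smooth_section W s ->
    smooth_section W (fun y => cov y (X y) s)
}.

Definition cov_endo (nabla : connection) (N : forall x, 'End(E x))
    (x : M) (v : (M -> R) -> R) (s : forall y, E y) : E x :=
  nabla x v (fun y => N y (s y)) - N x (nabla x v s).

Definition parallel (nabla : connection) (N : forall x, 'End(E x)) : Prop :=
  forall x v s, tangent x v -> smooth_section_near x s ->
    cov_endo nabla N x v s = 0.

End Bundles.

Section MatrixGroups.
Variable R : realType.

Definition Jmx (p q : nat) : 'M[R]_(p + q) :=
  block_mx 1%:M 0 0 (- 1%:M).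

Definition SOpq (p q : nat) : set 'M[R]_(p + q) :=
  [set A | A^T *m Jmx p q *m A = Jmx p q /\ \det A = 1].

(* Lie algebra of a Lie subgroup K of GL(r), as its tangent space at 1:
   the initial velocities of the smooth curves in K starting at 1. *)
Definition lie_algebra (r : nat) (K : set 'M[R]_r) : set 'M[R]_r :=
  [set X | exists (d : R) (g : R -> 'M[R]_r),
    [/\ 0 < d, g 0 = 1%:M,
        forall t, `|t| < d -> K (g t) /\ forall k, derivable (derive1n k g) t 1 &
        derive1 g 0 = X]].

(* eps = true stands for the sign +, eps = false for the sign - *)
Definition Ieps (n : nat) (eps : bool) : 'M[R]_n :=
  diag_mx (\row_(i < n) if (i == 0%N :> nat) && ~~ eps then -1 else 1).

Definition I'mx (n : nat) (eps : bool) : 'M[R]_((n + n) + (n + n)) :=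
  block_mx 1%:M 0 0 (block_mx 1%:M 0 0 (Ieps n eps)).

Definition Lambda (n : nat) : 'M[R]_((n + n) + (n + n)) :=
  block_mx (block_mx 0 (- 1%:M) 1%:M 0) (block_mx 0 1%:M 1%:M 0)
           (block_mx 0 1%:M 1%:M 0) (block_mx 0 (- 1%:M) 1%:M 0).

Definition Ggroup (n : nat) : set 'M[R]_((n + n) + (n + n)) :=
  [set A | @SOpq (n + n) (n + n) A /\ A *m Lambda n = Lambda n *m A].

End MatrixGroups.

Arguments SOpq : clear implicits.
Arguments Ggroup : clear implicits.

Section Metrics.
Variables (R : realType) (m : nat) (M : manifold R m) (p q : nat).
Variable E : vbundle M (p + q).

Definition pseudo_orthonormal (V : vectType R) (h : V -> V -> R)
    (e : 'I_(p + q) -> V) : Prop :=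
  forall i j, h (e i) (e j) = Jmx R p q i j.

(* bundle metric of signature (p, q) *)
Record bundle_metric := BundleMetric {
  ip :> forall x, E x -> E x -> R;
  ip_sym : forall x (u w : E x), ip u w = ip w u;
  ip_linear : forall x a (u u' w : E x),
    ip (a *: u + u') w = a * ip u w + ip u' w;
  ip_smooth : forall (W : set M) (s t : forall x, E x), open W ->
    smooth_section W s -> smooth_section W t ->
    smooth_on W (fun x => ip (s x) (t x));
  ip_signature : forall x, exists e : 'I_(p + q) -> E x,
    is_frame e /\ pseudo_orthonormal (@ip x) e
}.

Definition metric_connection (h : bundle_metric) (nabla : connection E) :
    Prop :=
  forall x v s t, tangent x v ->
    smooth_section_near x s -> smooth_section_near x t ->
    v (fun y => h y (s y) (t y)) =
      h x (nabla x v s) (t x) + h x (s x) (nabla x v t).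

End Metrics.

Section NilpotentStructures.
Variables (R : realType) (m n : nat) (M : manifold R m).
Variable E : vbundle M ((n + n) + (n + n)).
Variables (o : orientation E) (h : bundle_metric E).
Variable eps : bool.

Definition admissible (N : forall x, 'End(E x)) (U : set M)
    (e : forall x, 'I_((n + n) + (n + n)) -> E x) : Prop :=
  [/\ local_frame U e,
      forall x, U x -> pseudo_orthonormal (h x) (e x),
      forall x, U x -> o x (e x) &
      forall x, U x ->
        (fun j => N x (frame_mul (e x) (I'mx R n eps) j)) =
        frame_mul (frame_mul (e x) (I'mx R n eps)) (Lambda R n)].

Definition nilpotent_structure (N : forall x, 'End(E x)) : Prop :=
  smooth_endo N /\ forall x, exists U e, U x /\ admissible N U e.

(* For K a Lie subgroup of SO(2n, 2n), as for the closed subgroup Ggroup.  The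
   smoothness of A and omega is automatic, frames and connection being smooth. *)
Definition K_nilpotent_structure (K : set 'M[R]_((n + n) + (n + n)))
    (nabla : connection E) (N : forall x, 'End(E x)) : Prop :=
  nilpotent_structure N /\
  exists (L : Type) (U : L -> set M)
         (e : L -> forall x, 'I_((n + n) + (n + n)) -> E x),
  let e' l x := frame_mul (e l x) (I'mx R n eps) in
  [/\ \bigcup_l U l = setT,
      forall l, admissible N (U l) (e l),
      forall l l', U l `&` U l' !=set0 ->
        exists A : M -> 'M[R]_((n + n) + (n + n)),
        forall x, (U l `&` U l') x ->
          K (A x) /\ e' l' x = frame_mul (e' l x) (A x) &
      forall l, exists omega : M -> ((M -> R) -> R) ->
                               'M[R]_((n + n) + (n + n)),
        forall x v, U l x -> tangent x v ->
          lie_algebra K (omega x v) /\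
          (fun j => nabla x v (fun y => e' l y j)) =
          frame_mul (e' l x) (omega x v)].

End NilpotentStructures.

(* Main.v *)
Require Import Defs.
From mathcomp Require Import all_boot all_order all_algebra.
From mathcomp Require Import all_classical all_reals all_analysis.
From mathcomp Require Import ring.

(** Write [e'] for the frame [e I'], [e] an admissible frame of [N].  It is
    pseudo-orthonormal, satisfies [N e' = e' Lambda], and, if [omega] is the
    connection form of [nabla] with respect to [e'], then

      [(nabla_v N) e' = e' (omega Lambda - Lambda omega)].

    Hence [nabla N = 0] amounts to [omega] commuting with [Lambda] in every such
    frame ([cov_endo_frame]), while [nabla h = 0] says that [omega] is skew for
    [J], i.e. [omega^T J + J omega = 0] ([metric_connection_form]).

    The Lie algebra of [G] consists precisely of the matrices that are skew for
    [J] and commute with [Lambda].  That its elements commute with [Lambda]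
    follows by differentiating [g(t) Lambda = Lambda g(t)]
    ([lie_algebra_Ggroup_comm]).  Conversely, such a matrix [X] is the initial
    velocity of its Cayley transform [(1 - t X / 2)^-1 (1 + t X / 2)], a curve
    in [G] for small [t] whose entries are rational functions of [t], so that
    all its derivatives exist ([lie_algebra_Ggroup]).

    If [N] is [G]-nilpotent, [nabla N] therefore vanishes on the members of the
    given frames.  To pass to an arbitrary section [s], without expanding [s] in
    the frame, note that [J Lambda] is antisymmetric, so that [N] is skew for
    [h] ([endo_skew]); as [nabla] is metric, [nabla_v N] is skew too:
    [h((nabla_v N) s, e'_k) = - h(s, (nabla_v N) e'_k) = 0]
    ([parallel_of_frame]).

    If [N] is parallel, all admissible frames together form the required family:
    a transition matrix preserves [J] and commutes with [Lambda], because both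
    frames are adapted to [h] and [N], and its determinant is [1] because both
    frames give the orientation ([transition_Ggroup]). *)

Set Implicit Arguments.
Unset Strict Implicit.
Unset Printing Implicit Defensive.

Import Order.TTheory GRing.Theory Num.Theory.
Import numFieldNormedType.Exports.

Local Open Scope classical_set_scope.
Local Open Scope ring_scope.

(** * Matrix curves with rational entries *)

Section RationalCurves.
Variables (R : realType) (r : nat) (d : R).

Lemma near_norm_lt (t : R) : `|t| < d -> \forall s \near t, `|s| < d.
Proof.
by move=> td; exact: (@cvgr_norm_lt R R R _ _ id t (@cvg_id _ _) d td).
Qed.

Lemma rational_is_derive (p q : {poly R}) (t : R) : q.[t] != 0 ->
  is_derive t (1 : R) (fun s => p.[s] / q.[s])
    ((p^`() * q - p * q^`()).[t] / (q ^+ 2).[t]).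
Proof.
move=> qt.
have dq : derivable (horner q) t 1 by exact: derivable_horner.
have dp : derivable (horner p) t 1 by exact: derivable_horner.
have dV := derivableV qt dq.
have pq := derivableM dp dV.
apply: DeriveDef; first exact: pq.
have D (u : {poly R}) : 'D_1 (horner u) t = u^`().[t].
  by rewrite derivE derive1E.
apply: (etrans (deriveM dp dV)); rewrite (deriveV qt dq) !D.
rewrite !hornerE /GRing.scale/=; field.
by rewrite qt.
Qed.

Lemma rational_mx_derive (F : R -> 'M[R]_r) (p : 'M[{poly R}]_r) (q : {poly R}) :
  (forall t, `|t| < d -> q.[t] != 0) ->
  (forall t, `|t| < d -> F t = \matrix_(i, j) ((p i j).[t] / q.[t])) ->
  forall t, `|t| < d -> derivable F t 1 /\ derive1 F t =
    \matrix_(i, j) (((p i j)^`() * q - p i j * q^`()).[t] / (q ^+ 2).[t]).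
Proof.
move=> q0 FE t td.
have dFij i j : is_derive t (1 : R) (fun s => F s i j)
    (((p i j)^`() * q - p i j * q^`()).[t] / (q ^+ 2).[t]).
  apply: near_eq_is_derive (rational_is_derive (p i j) (q0 t td)).
  by apply: filterS (near_norm_lt td) => s sd; rewrite FE// mxE.
have dF : derivable F t 1.
  by apply/derivable_mxP => i j; have [+ _] := dFij i j.
split=> //; rewrite derive1E derive_mx//.
by apply/matrixP => i j; rewrite !mxE; have [_ <-] := dFij i j.
Qed.

(** The derivative of [p / q] is [(p' q - p q') / q^2], again a rational function
    whose denominator has no zero where [q] has none; so the property iterates. *)
Lemma rational_mx_smooth (F : R -> 'M[R]_r) (p : 'M[{poly R}]_r) (q : {poly R}) :
  (forall t, `|t| < d -> q.[t] != 0) ->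
  (forall t, `|t| < d -> F t = \matrix_(i, j) ((p i j).[t] / q.[t])) ->
  forall t, `|t| < d -> forall k, derivable (derive1n k F) t 1.
Proof.
move=> q0 FE t td k.
suff [p' [q' [q'0 Fk]]] : exists (p' : 'M[{poly R}]_r) (q' : {poly R}),
    (forall t, `|t| < d -> q'.[t] != 0) /\
    forall t, `|t| < d ->
      derive1n k F t = \matrix_(i, j) ((p' i j).[t] / q'.[t]).
  by have [] := rational_mx_derive q'0 Fk td.
elim: k {t td} => [|k [p' [q' [q'0 Fk]]]]; first by exists p, q.
exists (\matrix_(i, j) ((p' i j)^`() * q' - p' i j * q'^`())), (q' ^+ 2).
split=> t td; first by rewrite horner_exp expf_neq0// q'0.
rewrite derive1nS; have [_ ->] := rational_mx_derive q'0 Fk td.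
by apply/matrixP => i j; rewrite !mxE.
Qed.

End RationalCurves.

(** * The Lie algebra of the group and the Cayley transform *)

Section LieAlgebra.
Variable R : realType.

Lemma JmxK p q : Jmx R p q *m Jmx R p q = 1%:M.
Proof.
rewrite /Jmx mulmx_block !(mulmx0, mul0mx, addr0, add0r) !mul1mx.
by rewrite mulNmx mulmxN opprK mul1mx -scalar_mx_block.
Qed.

(** [J Lambda] is antisymmetric; this is what makes [N] skew for the metric. *)
Lemma Lambda_skew n :
  (Lambda R n)^T *m Jmx R (n + n) (n + n) =
  - (Jmx R (n + n) (n + n) *m Lambda R n).
Proof.
rewrite /Lambda /Jmx !tr_block_mx !mulmx_block.
rewrite !(mulmx0, mul0mx, addr0, add0r, mulmx1, mul1mx, mulmxN, mulNmx).
by rewrite !(trmx0, linearN) /= !trmx1 !opp_block_mx !oppr0 !opprK.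
Qed.

(** A curve commuting with a constant matrix has a velocity commuting with it. *)
Lemma is_derive_commutator r (g : R -> 'M[R]_r) (L : 'M[R]_r) (t : R) :
  derivable g t 1 ->
  (\forall s \near t, g s *m L = L *m g s) ->
  derive1 g t *m L = L *m derive1 g t.
Proof.
move=> dg gL.
have dge := (derivable_mxP _ _ _).1 dg.
rewrite derive1E derive_mx//; apply/matrixP => i j; rewrite !mxE.
have E1 : is_derive t 1 (\sum_k (L k j \*: (fun s => g s i k)))
   (\sum_k (L k j *: 'D_1 (fun s => g s i k) t)).
  by apply: is_derive_sum => k; apply: is_deriveZ; exact: derivableP.
have E2 : is_derive t 1 (\sum_k (L i k \*: (fun s => g s k j)))
   (\sum_k (L i k *: 'D_1 (fun s => g s k j) t)).
  by apply: is_derive_sum => k; apply: is_deriveZ; exact: derivableP.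
transitivity (\sum_k (L k j *: 'D_1 (fun s => g s i k) t)).
  by apply: eq_bigr => k _; rewrite !mxE mulrC.
transitivity (\sum_k (L i k *: 'D_1 (fun s => g s k j) t)); last first.
  by apply: eq_bigr => k _; rewrite !mxE.
rewrite -(@derive_val _ _ _ _ _ _ _ E1) -(@derive_val _ _ _ _ _ _ _ E2).
apply: near_eq_derive; apply: filterS gL => s /matrixP/(_ i j).
rewrite !mxE !fct_sumE => gL.
transitivity (\sum_k g s i k * L k j).
  by apply: eq_bigr => k _; rewrite mulrC.
by rewrite gL.
Qed.

Lemma lie_algebra_Ggroup_comm n (X : 'M[R]_((n + n) + (n + n))) :
  lie_algebra (Ggroup R n) X -> X *m Lambda R n = Lambda R n *m X.
Proof.
case=> d [g [d0 g0 gK <-]].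
apply: is_derive_commutator.
  by have := (gK 0 _).2; rewrite normr0 => /(_ d0 0%N).
have : \forall s \near (0 : R), `|s| < d.
  by apply: near_norm_lt; rewrite normr0.
by apply: filterS => s /gK[[_ ]].
Qed.

Lemma poly_neq0_near0 (q : {poly R}) : q.[0] != 0 ->
  exists2 d : R, 0 < d & forall t, `|t| < d -> q.[t] != 0.
Proof.
move=> q0.
have := @continuous_horner R q 0 [set y | y != 0].
case.
  by apply: open_nbhs_nbhs; split => //; exact: open_neq.
move=> d /= d0 dq; exists d => // t td; apply: dq => /=.
by rewrite sub0r normrN.
Qed.

(** [1 - t X / 2], the denominator of the Cayley transform of [t X]. *)
Definition cayley_den r (X : 'M[R]_r) (t : R) : 'M[R]_r :=
  1%:M - t *: (2^-1 *: X).

(** The Cayley transform [(1 + t X / 2) (1 - t X / 2)^-1] of [t X], written as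
    [1 + t X (1 - t X / 2)^-1]; see [cayley_num] for the product form.  It is
    meaningful only for those [t] that make [1 - t X / 2] invertible. *)
Definition cayley r (X : 'M[R]_r) (t : R) : 'M[R]_r :=
  1%:M + t *: (X *m invmx (cayley_den X t)).

(** [1 - t X / 2] as a matrix of polynomials in [t]. *)
Definition cayley_denp r (X : 'M[R]_r) : 'M[{poly R}]_r :=
  1%:M - 'X *: map_mx polyC (2^-1 *: X).

(** The Cayley transform times the determinant of its denominator, as a matrix of
    polynomials in [t]: the inverse is expressed by the adjugate. *)
Definition cayley_nump r (X : 'M[R]_r) : 'M[{poly R}]_r :=
  (\det (cayley_denp X))%:M +
    'X *: (map_mx polyC X *m \adj (cayley_denp X)).

Lemma map_cayley_denp r (X : 'M[R]_r) t :
  map_mx (horner_eval t) (cayley_denp X) = cayley_den X t.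
Proof.
apply/matrixP => i j; rewrite !mxE /horner_eval /= !hornerE.
by rewrite -mulr_natr hornerE; case: (i == j); rewrite ?hornerE.
Qed.

Lemma det_cayley_den r (X : 'M[R]_r) t :
  \det (cayley_den X t) = (\det (cayley_denp X)).[t].
Proof. by rewrite -map_cayley_denp det_map_mx. Qed.

Lemma cayley_rational r (X : 'M[R]_r) t : cayley_den X t \in unitmx ->
  cayley X t = \matrix_(i, j)
    ((cayley_nump X i j).[t] / (\det (cayley_denp X)).[t]).
Proof.
move=> Qu; have q0 : (\det (cayley_denp X)).[t] != 0.
  by rewrite -det_cayley_den -unitfE -unitmxE.
rewrite /cayley /invmx Qu -!scalemxAr scalerA.
apply/matrixP => i j.
rewrite [RHS]mxE mxE /cayley_nump [in RHS]mxE hornerD mulrDl; congr (_ + _).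
  rewrite !mxE; case: (i == j); last by rewrite !mulr0n horner0 mul0r.
  by rewrite !mulr1n mulfV.
rewrite det_cayley_den.
have -> : X *m \adj (cayley_den X t) =
  map_mx (horner_eval t) (map_mx polyC X *m \adj (cayley_denp X)).
  rewrite map_mxM map_mx_adj map_cayley_denp; congr (_ *m _).
  by apply/matrixP => k l; rewrite !mxE /= /horner_eval /= hornerC.
rewrite 2!mxE [in RHS]mxE hornerM hornerX.
by rewrite mulrAC.
Qed.

Lemma cayley_den_unit r (X : 'M[R]_r) : exists2 d : R, 0 < d &
  forall t, `|t| < d -> cayley_den X t \in unitmx.
Proof.
have [|d d0 dq] := @poly_neq0_near0 (\det (cayley_denp X)).
  by rewrite -det_cayley_den /cayley_den scale0r subr0 det1 oner_neq0.
by exists d => // t /dq; rewrite -det_cayley_den unitmxE unitfE.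
Qed.

Lemma cayley_smooth r (X : 'M[R]_r) (d : R) :
  (forall t, `|t| < d -> cayley_den X t \in unitmx) ->
  forall t, `|t| < d -> forall k, derivable (derive1n k (cayley X)) t 1.
Proof.
move=> Qu t td k.
apply: (rational_mx_smooth (d := d) (q := \det (cayley_denp X)) _ _ td).
- by move=> s /Qu; rewrite unitmxE det_cayley_den unitfE.
- by move=> s /Qu; exact: cayley_rational.
Qed.

Lemma cayley_derive0 r (X : 'M[R]_r) : derive1 (cayley X) 0 = X.
Proof.
have [d d0 Qu] := cayley_den_unit X.
have q0 s : `|s| < d -> (\det (cayley_denp X)).[s] != 0.
  by move=> /Qu; rewrite unitmxE det_cayley_den unitfE.
have d00 : `|0 : R| < d by rewrite normr0.
have [_ ->] :=
  rational_mx_derive q0 (fun s sd => cayley_rational (Qu s sd)) d00.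
set q := \det _; pose adj := \adj (cayley_denp X).
have qE : q.[0] = 1.
  by rewrite /q -det_cayley_den /cayley_den scale0r subr0 det1.
have adjE : map_mx (horner_eval 0) adj = 1%:M.
  by rewrite /adj map_mx_adj map_cayley_denp /cayley_den scale0r subr0 adj1.
apply/matrixP => i j; rewrite mxE hornerE horner_exp qE expr1n invr1 mulr1.
have -> : cayley_nump X i j =
    q *+ (i == j) + 'X * (map_mx polyC X *m adj) i j.
  by rewrite /cayley_nump -/q -/adj 3!mxE.
rewrite derivD derivMn derivM derivX mul1r !hornerE hornerMn hornerMn.
rewrite -/q qE.
have -> : ((map_mx polyC X *m adj) i j).[0] = X i j.
  transitivity (map_mx (horner_eval 0) (map_mx polyC X *m adj) i j).
    by rewrite [RHS]mxE.
  by rewrite map_mxM adjE mulmx1 !mxE /= /horner_eval /= hornerC.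
rewrite !(mulr1, mul0r) /=.
by case: (i == j); rewrite ?mulr1n ?mulr0n /=; ring.
Qed.

Lemma cayley_den_commutes r (X L : 'M[R]_r) t :
  X *m L = L *m X -> cayley_den X t *m L = L *m cayley_den X t.
Proof.
move=> XL; rewrite /cayley_den mulmxBl mulmxBr mulmx1 mul1mx.
by rewrite -!scalemxAl -!scalemxAr XL.
Qed.

Lemma cayley_den_comm r (X : 'M[R]_r) s t :
  cayley_den X s *m cayley_den X t = cayley_den X t *m cayley_den X s.
Proof. by do 2![apply: cayley_den_commutes; apply/esym]. Qed.

Section Isometry.
Variables (r : nat) (J L X : 'M[R]_r).
Hypothesis JK : J *m J = 1%:M.
Hypothesis XJ : X^T *m J + J *m X = 0.
Hypothesis XL : X *m L = L *m X.

Lemma cayley_num t : cayley_den X t \in unitmx ->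
  cayley X t = cayley_den X (- t) *m invmx (cayley_den X t).
Proof.
move=> Qu; rewrite /cayley -{1}(mulmxV Qu) scalemxAl -mulmxDl; congr (_ *m _).
rewrite /cayley_den scaleNr opprK -addrA; congr (_ + _).
rewrite !scalerA addrC -scalerBl; congr (_ *: _).
by rewrite {1}(splitr t) addrK.
Qed.

Lemma cayley_den_adjoint t :
  (cayley_den X t)^T *m J = J *m cayley_den X (- t).
Proof.
have E : X^T *m J = - (J *m X) by apply/eqP; rewrite -addr_eq0 XJ.
have -> : (cayley_den X t)^T = 1%:M - t *: (2^-1 *: X^T).
  by apply/matrixP => i j; rewrite !mxE eq_sym.
rewrite /cayley_den mulmxBl mulmxBr mulmx1 mul1mx.
by rewrite -!scalemxAl -!scalemxAr E !scalerN scaleNr.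
Qed.

Lemma cayley_isometry t : cayley_den X t \in unitmx ->
  (cayley X t)^T *m J *m cayley X t = J.
Proof.
move=> Qu; rewrite cayley_num// trmx_mul -!mulmxA.
rewrite (mulmxA _ J) cayley_den_adjoint opprK -(mulmxA J).
rewrite (mulmxA (cayley_den X t)) cayley_den_comm.
rewrite -(mulmxA _ _ (invmx _)) mulmxV// mulmx1.
have <- : (cayley_den X t)^T *m J = J *m cayley_den X (- t).
  exact: cayley_den_adjoint.
by rewrite mulmxA -trmx_mul mulmxV// trmx1 mul1mx.
Qed.

Lemma det_cayley t : cayley_den X t \in unitmx -> \det (cayley X t) = 1.
Proof.
move=> Qu; rewrite cayley_num// det_mulmx det_inv.
have J0 : \det J != 0.
  apply/eqP => J0; have := congr1 determinant JK.
  by rewrite det_mulmx J0 mul0r det1 => /eqP; rewrite eq_sym oner_eq0.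
have : \det (cayley_den X t) * \det J = \det J * \det (cayley_den X (- t)).
  by rewrite -[X in X * _]det_tr -!det_mulmx cayley_den_adjoint.
rewrite mulrC => /(mulfI J0) <-.
by rewrite mulfV// -unitfE -unitmxE.
Qed.

Lemma cayley_commutes t : cayley_den X t \in unitmx ->
  cayley X t *m L = L *m cayley X t.
Proof.
move=> Qu; have QL := cayley_den_commutes t XL.
have QVL : invmx (cayley_den X t) *m L = L *m invmx (cayley_den X t).
  by rewrite -{1}(mulmxK Qu L) -QL !mulmxA mulVmx// mul1mx.
rewrite /cayley mulmxDl mulmxDr mul1mx mulmx1 -scalemxAl -scalemxAr.
by rewrite -mulmxA QVL !mulmxA XL.
Qed.

End Isometry.

(** For small [t], the Cayley transform of [t X] is a smooth curve in the group,
    with initial velocity [X]. *)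
Lemma lie_algebra_Ggroup n (X : 'M[R]_((n + n) + (n + n))) :
  X^T *m Jmx R (n + n) (n + n) + Jmx R (n + n) (n + n) *m X = 0 ->
  X *m Lambda R n = Lambda R n *m X -> lie_algebra (Ggroup R n) X.
Proof.
move=> XJ XL; have [d d0 Qu] := cayley_den_unit X.
exists d, (cayley X); split=> //; last exact: cayley_derive0.
  by rewrite /cayley scale0r addr0.
move=> t td; split; last exact: cayley_smooth td.
split; last exact: cayley_commutes (Qu _ td).
split; first exact: cayley_isometry (Qu _ td).
exact: (det_cayley (JmxK _ _) XJ (Qu _ td)).
Qed.

End LieAlgebra.

(** * Frames of a vector space *)

Section FrameAlgebra.
Variables (R : realType) (V : vectType R) (r : nat).
Implicit Types (e : 'I_r -> V) (A B : 'M[R]_r) (u : V).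

Lemma frame_mulA e A B : frame_mul (frame_mul e A) B = frame_mul e (A *m B).
Proof.
apply/funext => j; rewrite /frame_mul.
transitivity (\sum_i \sum_k (A k i * B i j) *: e k).
  apply: eq_bigr => i _; rewrite scaler_sumr.
  by apply: eq_bigr => k _; rewrite scalerA mulrC.
rewrite exchange_big; apply: eq_bigr => k _.
by rewrite mxE scaler_suml.
Qed.

Lemma frame_mul1 e : frame_mul e 1%:M = e.
Proof.
apply/funext => j; rewrite /frame_mul (bigD1 j)//= mxE eqxx scale1r.
rewrite big1 ?addr0// => i ij; rewrite mxE (negbTE ij) scale0r//.
Qed.

Lemma frame_mulB e A B j :
  frame_mul e (A - B) j = frame_mul e A j - frame_mul e B j.
Proof.
rewrite /frame_mul -sumrB; apply: eq_bigr => i _.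
by rewrite !mxE scalerBl.
Qed.

Lemma frame_mul0 e j : frame_mul e 0 j = 0.
Proof. by rewrite /frame_mul big1// => i _; rewrite mxE scale0r. Qed.

Lemma frame_expand e u : is_frame e -> u = \sum_i frame_coord e i u *: e i.
Proof.
move=> fe; rewrite {1}(coord_basis fe (memvf u)); apply: eq_bigr => i _.
by rewrite (nth_map i) ?size_enum_ord// nth_ord_enum.
Qed.

Lemma frame_expand_mul e (f : 'I_r -> V) : is_frame e ->
  f = frame_mul e (\matrix_(i, j) frame_coord e i (f j)).
Proof.
move=> fe; apply/funext => j; rewrite {1}(frame_expand (f j) fe).
by apply: eq_bigr => i _; rewrite mxE.
Qed.

(** A single vector as each member of a family [e A], [A] having equal columns; this
    makes the matrix formulas for the metric applicable to it. *)
Lemma frame_expand_const e u k : is_frame e ->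
  u = frame_mul e (\matrix_(i, j) frame_coord e i u) k.
Proof. by move=> fe; rewrite -(frame_expand_mul (fun=> u) fe). Qed.

Lemma frame_mul_eq0 e A : is_frame e -> (forall j, frame_mul e A j = 0) -> A = 0.
Proof.
move=> fe A0; apply/matrixP => i j; rewrite mxE.
have /freeP fr : free [tuple e k | k < r] by exact: basis_free fe.
have := A0 j; rewrite /frame_mul => S0.
apply: (fr (fun k => A k j)).
rewrite -[RHS]S0; apply: eq_bigr => k _.
by rewrite (nth_map k) ?size_enum_ord// nth_ord_enum.
Qed.

Lemma is_frame_mul e A : is_frame e -> A \in unitmx -> is_frame (frame_mul e A).
Proof.
move=> fe Au; rewrite /is_frame basisEdim size_tuple.
have -> : \dim {:V} = r by rewrite -(size_basis fe).
rewrite leqnn andbT -(span_basis fe).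
apply/span_subvP => u /tnthP[i ->]; rewrite tnth_mktuple.
have -> : e i = \sum_k invmx A k i *: frame_mul e A k.
  by rewrite -{1}(frame_mul1 e) -(mulmxV Au) -frame_mulA.
apply: memv_suml => k _; apply: memvZ; apply: memv_span.
by apply/tnthP; exists k; rewrite tnth_mktuple.
Qed.

Lemma frame_coord_lin e i a u w :
  frame_coord e i (a *: u + w) = a * frame_coord e i u + frame_coord e i w.
Proof. exact: linearP. Qed.

End FrameAlgebra.

(** * Smooth functions and sections *)

Section SmoothCalculus.
Variables (R : realType) (m : nat).
Implicit Types (U V : set 'rV[R]_m) (f g : 'rV[R]_m -> R).

Lemma Ck_sub k U V f : U `<=` V -> Ck k V f -> Ck k U f.
Proof.
elim: k f => [|k IH] f UV [cf df].
  by split=> // x /UV; exact: cf.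
split=> [x /UV|i]; first exact: cf.
by have [dfi Cf] := df i; split=> [x /UV|]; [exact: dfi|exact: IH].
Qed.

Lemma Ck_ext k U f g : open U -> (forall x, U x -> f x = g x) ->
  Ck k U f -> Ck k U g.
Proof.
move=> oU.
have near_fg (u w : 'rV[R]_m -> R) x :
    (forall y, U y -> u y = w y) -> U x -> \forall y \near x, u y = w y.
  move=> uw Ux; have := open_nbhs_nbhs (conj oU Ux).
  by apply: filterS => y; exact: uw.
have cont (u w : 'rV[R]_m -> R) x : (forall y, U y -> u y = w y) -> U x ->
    {for x, continuous u} -> {for x, continuous w}.
  move=> uw Ux cu; rewrite /prop_for /continuous_at -(uw _ Ux).
  exact: cvg_trans (@near_eq_cvg _ _ (nbhs x) _ _ _ (near_fg _ _ _ uw Ux)) cu.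
elim: k f g => [|k IH] f g fg [cf df].
  by split=> // x Ux; apply: cont fg Ux (cf x Ux).
split=> [x Ux|i]; first exact: cont fg Ux (cf x Ux).
have [dfi Cf] := df i; split=> [x Ux|].
  exact: near_eq_derivable (near_fg _ _ _ fg Ux) (dfi x Ux).
apply: IH Cf => x Ux; exact: near_eq_derive (near_fg _ _ _ fg Ux).
Qed.

Lemma Ck_cst k U (a : R) : Ck k U (fun=> a).
Proof.
have cont b : forall x, U x -> {for x, continuous (fun=> b : R)}.
  by move=> x _; exact: (@cst_continuous _ R b x).
elim: k a => [|k IH] a; first by split=> //; exact: cont.
split=> [|i]; first exact: cont.
split=> [x _|]; first exact: derivable_cst.
have -> : 'D_(delta_mx 0 i) (fun=> a) = (fun=> 0) :> ('rV[R]_m -> R).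
  by apply/funext => x; exact: derive_cst.
exact: IH.
Qed.

Lemma Ck_lin k U (a : R) f g : open U -> Ck k U f -> Ck k U g ->
  Ck k U (fun x => a * f x + g x).
Proof.
move=> oU.
have cont (u w : 'rV[R]_m -> R) x : {for x, continuous u} ->
    {for x, continuous w} -> {for x, continuous (fun x => a * u x + w x)}.
  by move=> cu cw; apply: cvgD cw; exact: cvgMr.
elim: k f g => [|k IH] f g [cf df] [cg dg].
  by split=> // x Ux; exact: cont (cf x Ux) (cg x Ux).
split=> [x Ux|i]; first exact: cont (cf x Ux) (cg x Ux).
have [dfi Cf] := df i; have [dgi Cg] := dg i; split=> [x Ux|].
  by have D := derivableD (derivableZ (k := a) (dfi x Ux)) (dgi x Ux); exact: D.
apply: Ck_ext oU _ (IH _ _ Cf Cg) => x Ux; apply/esym.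
apply: (etrans (deriveD (derivableZ (k := a) (dfi x Ux)) (dgi x Ux))).
by rewrite deriveZ//; exact: dfi.
Qed.

End SmoothCalculus.

Section SmoothOnManifold.
Variables (R : realType) (m : nat) (M : manifold R m).
Implicit Types (W : set M) (f g : M -> R).

(** The sets on which smoothness is tested in a chart are open, so that smoothness
    there is insensitive to the values taken elsewhere. *)
Lemma open_chart_image W (c : chart R m M) : open W ->
  open (phi c @` (dom c `&` W)).
Proof.
move=> oW.
have -> : phi c @` (dom c `&` W) = phi c @` dom c `&` psi c @^-1` W.
  apply/seteqP; split=> u.
    move=> [y [cy Wy] <-]; split; first by exists y.
    by rewrite /= phiK// inE.
  move=> [[y cy <-]]; rewrite /= phiK ?inE// => Wy.
  by exists y.
have := @psi_cont _ _ _ c.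
rewrite continuous_open_subspace; last exact: img_open.
rewrite openE => ct u [uU Wu].
apply: (@filterI _ (nbhs u)).
  by apply: open_nbhs_nbhs; split; [exact: img_open|exact: uU].
by apply: ct; [rewrite inE|exact: open_nbhs_nbhs].
Qed.

Lemma smooth_on_sub W W' f : W `<=` W' -> smooth_on W' f -> smooth_on W f.
Proof.
move=> WW' sf c ac k; apply: Ck_sub (sf c ac k).
by move=> _ [y [cy Wy] <-]; exists y => //; split=> //; exact: WW'.
Qed.

Lemma smooth_on_cst W (a : R) : smooth_on W (fun=> a).
Proof. by move=> c ac k; exact: Ck_cst. Qed.

Lemma smooth_on_lin W (a : R) f g : open W -> smooth_on W f -> smooth_on W g ->
  smooth_on W (fun x => a * f x + g x).
Proof.
move=> oW sf sg c ac k.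
exact: (Ck_lin a (open_chart_image oW) (sf c ac k) (sg c ac k)).
Qed.

Lemma smooth_near_cst (x : M) (a : R) : smooth_near x (fun=> a).
Proof. by exists setT; split; [exact: openT| |exact: smooth_on_cst]. Qed.

(** A derivation kills the constants, since it kills [1 = 1 * 1]. *)
Lemma tangent_cst (x : M) v (a : R) : tangent x v -> v (fun=> a) = 0.
Proof.
case=> _ lin mult _; have c1 := smooth_near_cst x 1.
have v1 : v (fun=> 1) = 0.
  have := mult _ _ c1 c1; rewrite (_ : (fun=> 1 * 1) = (fun=> 1)); last first.
    by apply/funext => y; rewrite mulr1.
  rewrite mulr1 mul1r => /eqP.
  by rewrite -subr_eq0 opprD addNKr oppr_eq0 => /eqP.
(* [a = (a - 1) * 1 + 1] *)
have := lin (a - 1) _ _ c1 c1; rewrite v1 mulr0 addr0 => <-.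
by congr v; apply/funext => y; rewrite mulr1 subrK.
Qed.

End SmoothOnManifold.

Section Sections.
Variables (R : realType) (m : nat) (M : manifold R m) (r : nat).
Variable E : vbundle M r.
Implicit Types (W : set M) (s t : forall x, E x).

Lemma smooth_section_sub W W' s :
  W `<=` W' -> smooth_section W' s -> smooth_section W s.
Proof.
by move=> WW' ss U e Ue i; apply: smooth_on_sub (ss U e Ue i); exact: setIS.
Qed.

Lemma smooth_section_lin W (a : R) s t : open W ->
  smooth_section W s -> smooth_section W t ->
  smooth_section W (fun x => a *: s x + t x).
Proof.
move=> oW ss st U e Ue i.
under eq_fun do rewrite frame_coord_lin.
apply: smooth_on_lin (ss U e Ue i) (st U e Ue i).
by apply: openI => //; exact: triv_open Ue.
Qed.

Lemma smooth_section0 W : smooth_section W (fun x => 0 : E x).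
Proof.
move=> U e Ue i; under eq_fun do rewrite /frame_coord linear0.
exact: smooth_on_cst.
Qed.

Lemma smooth_section_sum W (I : Type) (l : seq I) (a : I -> R)
    (s : I -> forall x, E x) : open W -> (forall i, smooth_section W (s i)) ->
  smooth_section W (fun x => \sum_(i <- l) a i *: s i x).
Proof.
move=> oW ss; elim: l => [|i l IH].
  rewrite (_ : (fun x => _) = (fun x => 0)); first exact: smooth_section0.
  by apply: functional_extensionality_dep => x; rewrite big_nil.
rewrite (_ : (fun x => _) =
    fun x => a i *: s i x + \sum_(j <- l) a j *: s j x).
  exact: smooth_section_lin.
by apply: functional_extensionality_dep => x; rewrite big_cons.
Qed.

Variable nabla : connection E.

Lemma cov_scale x v (a : R) s : tangent x v -> smooth_section_near x s ->
  nabla x v (fun y => a *: s y) = a *: nabla x v s.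
Proof.
move=> tv ss; rewrite (cov_leibniz _ tv (smooth_near_cst x a) ss).
by rewrite (tangent_cst _ tv) scale0r add0r.
Qed.

Lemma cov_sum W x v (I : Type) (l : seq I) (a : I -> R)
    (s : I -> forall x, E x) :
  open W -> W x -> tangent x v -> (forall i, smooth_section W (s i)) ->
  nabla x v (fun y => \sum_(i <- l) a i *: s i y) =
  \sum_(i <- l) a i *: nabla x v (s i).
Proof.
move=> oW Wx tv ss.
have near t : smooth_section W t -> smooth_section_near x t by exists W.
elim: l => [|i l IH].
  rewrite big_nil; have := cov_scale 0 tv (near _ (@smooth_section0 W)).
  rewrite scale0r => <-; congr (nabla x v _).
  by apply: functional_extensionality_dep => y; rewrite big_nil scaler0.
rewrite big_cons -IH -cov_scale//; last exact: near.
rewrite -cov_add//; last 2 first.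
- apply: near; rewrite (_ : (fun y => _) = (fun y => a i *: s i y + 0)).
    by apply: smooth_section_lin => //; exact: smooth_section0.
  by apply: functional_extensionality_dep => y; rewrite addr0.
- by apply: near; exact: smooth_section_sum.
congr (nabla x v _).
by apply: functional_extensionality_dep => y; rewrite big_cons.
Qed.

End Sections.

(** * Pseudo-orthonormal frames and isometry matrices *)

Section MetricAlgebra.
Variables (R : realType) (m : nat) (M : manifold R m) (p q : nat).
Variables (E : vbundle M (p + q)) (h : bundle_metric E).

Lemma ip_suml x (I : Type) (l : seq I) (a : I -> R) (u : I -> E x) w :
  h x (\sum_(i <- l) a i *: u i) w = \sum_(i <- l) a i * h x (u i) w.
Proof.
elim: l => [|i l IH]; last by rewrite !big_cons ip_linear IH.
rewrite !big_nil; have := ip_linear h (- 1) (0 : E x) 0 w.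
by rewrite scaler0 addr0 mulN1r addNr.
Qed.

Lemma ip_sumr x (I : Type) (l : seq I) (a : I -> R) (u : I -> E x) w :
  h x w (\sum_(i <- l) a i *: u i) = \sum_(i <- l) a i * h x w (u i).
Proof. by rewrite ip_sym ip_suml; apply: eq_bigr => i _; rewrite ip_sym. Qed.

Lemma ipBl x (u t w : E x) : h x (u - t) w = h x u w - h x t w.
Proof. by rewrite addrC -scaleN1r ip_linear mulN1r addrC. Qed.

Lemma ipNr x (u w : E x) : h x u (- w) = - h x u w.
Proof.
by rewrite -sub0r ip_sym ipBl -{1}(subrr w) ipBl subrr sub0r ip_sym.
Qed.

Lemma ip_frame_mul x (e f : 'I_(p + q) -> E x) (A B : 'M[R]_(p + q)) i j :
  h x (frame_mul e A i) (frame_mul f B j) =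
  (A^T *m (\matrix_(k, l) h x (e k) (f l)) *m B) i j.
Proof.
rewrite /frame_mul ip_sumr mxE; apply: eq_bigr => l _; rewrite ip_suml mulrC.
by congr (_ * _); rewrite mxE; apply: eq_bigr => k _; rewrite !mxE.
Qed.

Lemma orthonormal_ip_frame_mul x (e : 'I_(p + q) -> E x) A B i j :
  pseudo_orthonormal (h x) e ->
  h x (frame_mul e A i) (frame_mul e B j) = (A^T *m Jmx R p q *m B) i j.
Proof.
move=> oe; rewrite ip_frame_mul; congr ((_ *m _ *m _) i j).
by apply/matrixP => k l; rewrite mxE oe.
Qed.

(** Nondegeneracy of the metric, tested on a frame. *)
Lemma orthonormal_frame_eq0 x (e : 'I_(p + q) -> E x) u :
  is_frame e -> pseudo_orthonormal (h x) e ->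
  (forall k, h x u (e k) = 0) -> u = 0.
Proof.
move=> fe oe u0.
pose A : 'M[R]_(p + q) := \matrix_(i, j) frame_coord e i u.
have AJ : A^T *m Jmx R p q = 0.
  apply/matrixP => j k; have := orthonormal_ip_frame_mul A 1%:M j k oe.
  rewrite frame_mul1 mulmx1 -(frame_expand_const u j fe) u0 => <-.
  by rewrite mxE.
have A0 : A = 0.
  by apply: trmx_inj; rewrite -[LHS]mulmx1 -(JmxK R p q) mulmxA AJ mul0mx trmx0.
rewrite (frame_expand u fe) big1// => i _.
have := congr1 (fun B : 'M[R]_(p + q) => B i i) A0.
by rewrite !mxE => ->; rewrite scale0r.
Qed.

End MetricAlgebra.

Section SignMatrix.
Variable R : realType.

Lemma diag_signK n (d : 'rV[R]_n) : (forall i, d 0 i * d 0 i = 1) ->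
  diag_mx d *m diag_mx d = 1%:M.
Proof.
move=> dd; rewrite mulmx_diag; apply/matrixP => i j; rewrite !mxE.
by rewrite dd.
Qed.

Lemma IepsK n eps : Ieps R n eps *m Ieps R n eps = 1%:M.
Proof.
apply: diag_signK => i; rewrite mxE.
by case: ifP; rewrite ?mulrNN mulr1.
Qed.

Lemma I'mxK n eps : I'mx R n eps *m I'mx R n eps = 1%:M.
Proof.
rewrite /I'mx !mulmx_block !(mulmx0, mul0mx, addr0, add0r, mulmx1) IepsK.
by rewrite -!scalar_mx_block.
Qed.

Lemma I'mx_unit n eps : I'mx R n eps \in unitmx.
Proof. by have [] := mulmx1_unit (I'mxK n eps). Qed.

Lemma I'mx_isometry n eps :
  (I'mx R n eps)^T *m Jmx R (n + n) (n + n) *m I'mx R n eps =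
  Jmx R (n + n) (n + n).
Proof.
have tI : (Ieps R n eps)^T = Ieps R n eps by rewrite tr_diag_mx.
rewrite /I'mx /Jmx !tr_block_mx !trmx0 !trmx1 tI !mulmx_block.
rewrite !(mulmx0, mul0mx, addr0, add0r, mulmx1, mul1mx, mulmxN, mulNmx).
rewrite mulmx_block !(mulmx0, mul0mx, addr0, add0r, mulmx1) IepsK.
by rewrite -scalar_mx_block.
Qed.

Lemma det_I'mx_sqr n eps : \det (I'mx R n eps) * \det (I'mx R n eps) = 1.
Proof. by rewrite -det_mulmx I'mxK det1. Qed.

Lemma det_isometry_sqr p q (A : 'M[R]_(p + q)) :
  A^T *m Jmx R p q *m A = Jmx R p q -> \det A ^+ 2 = 1.
Proof.
move=> AJ; have J0 : \det (Jmx R p q) != 0.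
  by rewrite -unitfE -unitmxE; have [] := mulmx1_unit (JmxK R p q).
apply: (mulIf J0); rewrite mul1r -[RHS](congr1 determinant AJ).
by rewrite !det_mulmx det_tr expr2 mulrAC.
Qed.

End SignMatrix.

(** * Adapted frames and the covariant derivative of N *)

Section AdaptedFrames.
Variables (R : realType) (m n : nat) (M : manifold R m).
Variable E : vbundle M ((n + n) + (n + n)).
Variable h : bundle_metric E.
Variable nabla : connection E.
Hypothesis hnabla : metric_connection h nabla.
Variable N : forall x, 'End(E x).
Hypothesis sN : smooth_endo N.

Local Notation J := (Jmx R (n + n) (n + n)).
Local Notation L := (Lambda R n).

(** A pseudo-orthonormal local frame [f] with [N f = f Lambda], such as [e I'] for
    an admissible frame [e].  The orientation is left out, as it matters only for
    the determinants of transition matrices. *)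
Record adapted (W : set M) (f : forall x, 'I_((n + n) + (n + n)) -> E x) := {
  adapted_frame : local_frame W f;
  adapted_orthonormal : forall x, W x -> pseudo_orthonormal (h x) (f x);
  adapted_Lambda : forall x, W x -> (fun j => N x (f x j)) = frame_mul (f x) L
}.

Lemma admissible_adapted (o : orientation E) eps W e :
  admissible o h eps N W e ->
  adapted W (fun x => frame_mul (e x) (I'mx R n eps)).
Proof.
case=> -[oW fe se] oe _ Ne; split=> //.
- split=> // [x Wx|i]; first exact: is_frame_mul (fe x Wx) (I'mx_unit _ _ _).
  exact: smooth_section_sum.
- move=> x Wx i j.
  by rewrite (orthonormal_ip_frame_mul _ _ _ _ (oe x Wx)) I'mx_isometry.
Qed.

Variables (W : set M) (f : forall x, 'I_((n + n) + (n + n)) -> E x).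
Hypothesis adf : adapted W f.

Let oW : open W. Proof. by case: (adapted_frame adf). Qed.
Let ff x : W x -> is_frame (f x).
Proof. by have [_ + _] := adapted_frame adf; exact. Qed.
Let sf i : smooth_section W (fun x => f x i).
Proof. by have [_ _ +] := adapted_frame adf; exact. Qed.
Let fo x : W x -> pseudo_orthonormal (h x) (f x).
Proof. exact: (adapted_orthonormal adf). Qed.
Let Nf x j : W x -> N x (f x j) = frame_mul (f x) L j.
Proof. by move=> Wx; rewrite -(adapted_Lambda adf Wx). Qed.

Lemma endo_frame_mul x A j : W x ->
  N x (frame_mul (f x) A j) = frame_mul (f x) (L *m A) j.
Proof.
move=> Wx; rewrite -frame_mulA /frame_mul linear_sum; apply: eq_bigr => i _.
by rewrite linearZ/= Nf.
Qed.

Lemma endo_skew x (u w : E x) : W x -> h x (N x u) w = - h x u (N x w).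
Proof.
move=> Wx.
have base i j : h x (N x (f x i)) (f x j) = - h x (f x i) (N x (f x j)).
  have fE k : f x k = frame_mul (f x) 1%:M k by rewrite frame_mul1.
  rewrite !Nf// [in LHS](fE j) [in RHS](fE i).
  rewrite !(orthonormal_ip_frame_mul _ _ _ _ (fo Wx)) mulmx1 trmx1 mul1mx.
  by rewrite Lambda_skew mxE.
have baser k : h x (N x u) (f x k) = - h x u (N x (f x k)).
  rewrite [in LHS](frame_expand u (ff Wx)) [in RHS](frame_expand u (ff Wx)).
  rewrite linear_sum; under eq_bigr do rewrite linearZ/=.
  rewrite !ip_suml -sumrN; apply: eq_bigr => i _.
  by rewrite base mulrN.
rewrite [in LHS](frame_expand w (ff Wx)) [in RHS](frame_expand w (ff Wx)).
rewrite linear_sum; under [in RHS]eq_bigr do rewrite linearZ/=.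
by rewrite !ip_sumr -sumrN; apply: eq_bigr => k _; rewrite baser mulrN.
Qed.

Lemma cov_endo_frame x v (omega : 'M[R]_((n + n) + (n + n))) k :
  W x -> tangent x v ->
  (fun j => nabla x v (fun y => f y j)) = frame_mul (f x) omega ->
  cov_endo nabla N x v (fun y => f y k) =
    frame_mul (f x) (omega *m L - L *m omega) k.
Proof.
move=> Wx tv om; rewrite /cov_endo frame_mulB; congr (_ - _); last first.
  by rewrite (congr1 (@^~ k) om) endo_frame_mul.
rewrite -frame_mulA -om /frame_mul -(cov_sum _ _ _ oW Wx tv sf).
apply: cov_local => //.
- exists W; split=> //; exact: sN.
- by exists W; split=> //; exact: smooth_section_sum.
- apply: filterS (open_nbhs_nbhs (conj oW Wx)) => y Wy.
  exact: Nf.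
Qed.

(** Because [N] is skew for [h] and [nabla] is metric, the vanishing of
    [nabla_v N] on a frame implies its vanishing on every section. *)
Lemma parallel_of_frame x v s : W x -> tangent x v ->
  (forall k, cov_endo nabla N x v (fun y => f y k) = 0) ->
  smooth_section_near x s -> cov_endo nabla N x v s = 0.
Proof.
move=> Wx tv Tf [S [oS Sx ss0]].
pose W' := W `&` S.
have oW' : open W' by exact: openI.
have ss : smooth_section W' s by apply: smooth_section_sub ss0 => y [].
have sf' k : smooth_section W' (fun y => f y k).
  by apply: smooth_section_sub (sf k) => y [].
have near (t : forall y, E y) :
    smooth_section W' t -> smooth_section_near x t by exists W'.
apply: (orthonormal_frame_eq0 (ff Wx) (fo Wx)) => k.
have sNs := sN oW' ss; have sNf := sN oW' (sf' k).
have sNf' : smooth_section W' (fun y => -1 *: N y (f y k)).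
  rewrite (_ : (fun y => _) = fun y => -1 *: N y (f y k) + 0).
    by apply: smooth_section_lin => //; exact: smooth_section0.
  by apply: functional_extensionality_dep => y; rewrite addr0.
(* Differentiate [h(N s, f_k) = h(s, - N f_k)] along [v]. *)
have vE : v (fun y => h y (N y (s y)) (f y k)) =
          v (fun y => h y (s y) (-1 *: N y (f y k))).
  case: (tv) => loc _ _ _; apply: loc.
  - by exists W'; split=> //; exact: ip_smooth.
  - by exists W'; split=> //; exact: ip_smooth.
  - have := open_nbhs_nbhs (conj oW Wx); apply: filterS => y Wy.
    by rewrite scaleN1r ipNr endo_skew.
move: vE; rewrite (hnabla tv (near _ sNs) (near _ (sf' k))).
rewrite (hnabla tv (near _ ss) (near _ sNf')).
rewrite (cov_scale _ _ tv (near _ sNf)) !scaleN1r !ipNr (endo_skew _ _ Wx).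
have /eqP := Tf k; rewrite /cov_endo subr_eq0 => /eqP ->.
move=> /addIr E'.
by rewrite ipBl E' (endo_skew _ _ Wx) subrr.
Qed.

Lemma metric_connection_form x v (omega : 'M[R]_((n + n) + (n + n))) :
  W x -> tangent x v ->
  (fun j => nabla x v (fun y => f y j)) = frame_mul (f x) omega ->
  omega^T *m J + J *m omega = 0.
Proof.
move=> Wx tv om; apply/matrixP => i j; rewrite !mxE.
have near k : smooth_section_near x (fun y => f y k) by exists W.
have fE k : f x k = frame_mul (f x) 1%:M k by rewrite frame_mul1.
have := hnabla tv (near i) (near j).
rewrite (congr1 (@^~ i) om) (congr1 (@^~ j) om) (fE i) (fE j).
rewrite !(orthonormal_ip_frame_mul _ _ _ _ (fo Wx)).
rewrite trmx1 mul1mx mulmx1 !mxE => <-.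
rewrite -(tangent_cst (J i j) tv); case: (tv) => loc _ _ _; apply: loc.
- by exists W; split=> //; exact: ip_smooth.
- exact: smooth_near_cst.
- apply: filterS (open_nbhs_nbhs (conj oW Wx)) => y Wy.
  by rewrite (fo Wy).
Qed.

End AdaptedFrames.

(** The matrix between the frames [f = e I'] and [f' = e' I'] of two admissible
    frames [e] and [e'] belongs to [G]. *)
Lemma transition_Ggroup (R : realType) (m n : nat) (M : manifold R m)
    (E : vbundle M ((n + n) + (n + n))) (o : orientation E)
    (h : bundle_metric E) eps (N : forall x, 'End(E x))
    (U U' : set M) (e e' : forall x, 'I_((n + n) + (n + n)) -> E x) x :
  let f := frame_mul (e x) (I'mx R n eps) in
  let f' := frame_mul (e' x) (I'mx R n eps) in
  let A := \matrix_(i, j) frame_coord f i (f' j) in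
  admissible o h eps N U e -> admissible o h eps N U' e' -> U x -> U' x ->
  Ggroup R n A /\ f' = frame_mul f A.
Proof.
move=> f f' A ad ad' Ux Ux'.
have adf := admissible_adapted ad; have adf' := admissible_adapted ad'.
have [_ ff _] := adapted_frame adf; have {}ff := ff x Ux.
have f'E : f' = frame_mul f A by exact: frame_expand_mul.
have fo := adapted_orthonormal adf Ux.
have of' := adapted_orthonormal adf' Ux'.
have AJ : A^T *m Jmx R (n + n) (n + n) *m A = Jmx R (n + n) (n + n).
  apply/matrixP => i j; rewrite -(orthonormal_ip_frame_mul A A i j fo).
  by rewrite -/f -f'E of'.
(* The isometry relation leaves two values for the determinant, 1 and -1. *)
have dA2 := det_isometry_sqr AJ.
have dA0 : \det A != 0 by rewrite -sqrf_eq0 dA2 oner_eq0.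
split=> //; split; last first.
  apply/eqP; rewrite -subr_eq0; apply/eqP; apply: (frame_mul_eq0 ff) => j.
  rewrite frame_mulB -(endo_frame_mul adf _ _ Ux) -/f -f'E.
  rewrite -[N x _]/((fun j => N x (f' j)) j) (adapted_Lambda adf' Ux') -/f' f'E.
  by rewrite frame_mulA subrr.
split=> //.
(* The orientation compares [e] and [e'], related by [B = I' A I']; [B] and [A]
   have the same determinant. *)
pose B := I'mx R n eps *m A *m I'mx R n eps.
have e'E : e' x = frame_mul (e x) B.
  rewrite /B -!frame_mulA -/f -f'E /f' frame_mulA I'mxK frame_mul1//.
have dB : \det B = \det A.
  by rewrite !det_mulmx mulrAC det_I'mx_sqr mul1r.
have [_ _ ox _] := ad; have [_ _ ox' _] := ad'.
have Bu : B \in unitmx by rewrite unitmxE dB unitfE.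
have := (pos_mul (ox x Ux) Bu).1; rewrite -e'E dB => /(_ (ox' x Ux')) dA.
by apply/eqP; move/eqP: dA2; rewrite sqrf_eq1 => /orP[//|/eqP dAN];
   move: dA; rewrite dAN ltr0N1.
Qed.

(** * Parallel and G-nilpotent structures *)

Theorem proposition4p3 (R : realType) (m n : nat) (hn : (0 < n)%N)
    (M : manifold R m) (E : vbundle M ((n + n) + (n + n)))
    (o : orientation E) (h : bundle_metric E)
    (nabla : connection E) (hnabla : metric_connection h nabla)
    (eps : bool) (N : forall x : M, 'End(E x))
    (hN : nilpotent_structure o h eps N) :
  K_nilpotent_structure o h eps (Ggroup R n) nabla N <-> parallel nabla N.
Proof.
have [sN locN] := hN.
split=> [[_ [I [U [e [cover adm _ conn]]]]] x v s tv ss|par].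
  have [l _ Ux] : (\bigcup_l U l) x by rewrite cover.
  have [omega /(_ x v Ux tv)[Lie om]] := conn l.
  have ad := admissible_adapted (adm l).
  apply: (parallel_of_frame hnabla sN ad Ux tv _ ss) => k.
  rewrite (cov_endo_frame sN ad k Ux tv om) (lie_algebra_Ggroup_comm Lie) subrr.
  exact: frame_mul0.
split=> //.
(* The family of frames is that of all admissible frames of [N]. *)
pose I := {p : set M * (forall x, 'I_((n + n) + (n + n)) -> E x) |
  admissible o h eps N p.1 p.2}.
have adm (l : I) : admissible o h eps N (sval l).1 (sval l).2.
  exact: (svalP l).
exists I, (fun l => (sval l).1), (fun l => (sval l).2).
split=> //.
- apply/seteqP; split=> // x _; have [U [e [Ux ad]]] := locN x.
  by exists (exist _ (U, e) ad).
- move=> l l' _.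
  exists (fun x => \matrix_(i, j) frame_coord
    (frame_mul ((sval l).2 x) (I'mx R n eps)) i
    (frame_mul ((sval l').2 x) (I'mx R n eps) j)).
  move=> x [Ux Ux'].
  exact: transition_Ggroup (adm l) (adm l') Ux Ux'.
- move=> l; have ad := admissible_adapted (adm l).
  exists (fun x v => \matrix_(i, j) frame_coord
    (frame_mul ((sval l).2 x) (I'mx R n eps)) i
    (nabla x v (fun y => frame_mul ((sval l).2 y) (I'mx R n eps) j))).
  move=> x v Ux tv.
  have [oU fU sU] := adapted_frame ad.
  have om := frame_expand_mul (fun j => nabla x v
    (fun y => frame_mul ((sval l).2 y) (I'mx R n eps) j)) (fU x Ux).
  split=> //; apply: lie_algebra_Ggroup.
    exact: (metric_connection_form hnabla ad Ux tv om).
  apply/eqP; rewrite -subr_eq0; apply/eqP.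
  apply: (frame_mul_eq0 (fU x Ux)) => k.
  rewrite -(cov_endo_frame sN ad k Ux tv om).
  by apply: par => //; exists (sval l).1; split=> //; exact: sU.
Qed.
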